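(* Let $\mathcal{M}$ be a real antisymmetric $n\times n$ matrix and let $\mathbf{C}_0(t)$ be a solution, on some time interval, of \[ \mathbf{C}_0'(t)=\frac{\mathcal{M}^2\mathbf{C}_0(t)}{\|\mathcal{M}\mathbf{C}_0(t)\|^2}. \] Then there is a $T\in\mathbb{R}$ such that $\|\mathbf{C}_0(t)\|^2=2(T-t)$ for all $t$ in the interval. Consequently, for each $t$ the curve $\epsilon\mapsto \mathbf{c}(t,\epsilon)=e^{\epsilon\mathcal{M}}\mathbf{C}_0(t)$ lies on the sphere of radius $\sqrt{2(T-t)}$ centered at the origin.
   Context: The vector $\mathbf{C}_0(t)\in\mathbb{R}^n$ satisfies $\mathcal{M}\mathbf{C}_0(t)\neq0$ on the interval considered, so that the differential equation makes sense. Prime denotes $d/dt$. *)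

(* Defs.v *)
From mathcomp Require Import all_boot all_order all_algebra.
From mathcomp Require Import all_classical all_reals all_analysis.
Import Order.TTheory GRing.Theory Num.Theory.
Import numFieldNormedType.Exports.

Set Implicit Arguments.
Unset Strict Implicit.
Unset Printing Implicit Defensive.

Local Open Scope classical_set_scope.
Local Open Scope ring_scope.

(* The library norm `|v| on matrices is the sup norm; this is the Euclidean
   norm of R^n. *)
Definition enorm (R : realType) (n : nat) (v : 'cV[R]_n) : R :=
  Num.sqrt (\sum_(i < n) v i 0 ^+ 2).

Definition sphere (R : realType) (n : nat) (x : 'cV[R]_n) (r : R) :
  set 'cV[R]_n := [set y | enorm (y - x) = r].

Definition antisymmetric_mx (R : realType) (n : nat) (M : 'M[R]_n) : Prop :=
  M^T = - M.

Definition expmx (R : realType) (n : nat) (A : 'M[R]_n) : 'M[R]_n :=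
  limn (series (fun k : nat => (k`!%:R)^-1 *: A ^+ k)).

(* Derivative relative to A: two-sided at interior points of A, one-sided at
   the endpoints that an interval contains. Only the values of f on A matter. *)
Definition is_derive_within (R : realType) (V : normedModType R)
    (A : set R) (f : R -> V) (t : R) (df : V) : Prop :=
  (s - t)^-1 *: (f s - f t) @[s --> within A t^'] --> df.

(* The nonvanishing condition is part of being a solution, since in Rocq the
   right-hand side has a (junk) value even when M *m C t = 0. *)
Definition ode_solution (R : realType) (n : nat) (M : 'M[R]_n)
    (I : interval R) (C : R -> 'cV[R]_n) : Prop :=
  forall t : R, t \in I ->
    M *m C t != 0 /\
    is_derive_within [set` I] C t
      ((enorm (M *m C t) ^+ 2)^-1 *: (M ^+ 2 *m C t)).

Definition curve (R : realType) (n : nat) (M : 'M[R]_n) (C : R -> 'cV[R]_n)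
    (t eps : R) : 'cV[R]_n := expmx (eps *: M) *m C t.

(* Main.v *)
Require Import Defs.
From mathcomp Require Import all_boot all_order all_algebra.
From mathcomp Require Import all_classical all_reals all_analysis.
From mathcomp Require Import ring lra.
Import Order.TTheory GRing.Theory Num.Theory.
Import numFieldNormedType.Exports.

(** Along a solution, antisymmetry gives
    <C, M^2 C> = - <M C, M C>, hence
    (|C|^2)' = 2 <C, C'> = 2 <C, M^2 C> / |M C|^2 = - 2,
    so that |C(t)|^2 + 2 t has zero derivative on the interval and is constant
    there ([ode_solution_derive_sqr_norm], [is_derive_within_0_cst]).  The
    derivative is the one relative to the interval, so the mean value theorem
    is applied on segments [a, b] of it: two-sided differentiability holds in
    the interior of the segment, and continuity at its endpoints.

    The statement on the curve says that expmx A preserves the Euclidean norm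
    when A is antisymmetric ([expmx_antisymmetric_sqr_norm]).  Let S_N be the
    sum of the first N terms of the exponential series of A and put
    q m = <v, A^m v>.  Antisymmetry turns the squared norm of S_N v into
      sum_(j, k < N) (-1)^j 1^k / (j! k!) q (j + k).
    By the binomial theorem the terms with j + k < N add up to
    sum_(m < N) (-1 + 1)^m / m! q m = |v|^2 ([double_sum_triangle]).  Since
    |q m| <= c b^m, the remaining terms are bounded by
    c (S_N(b)^2 - S_N(2 b)), where S_N(x) is a partial sum of the exponential
    series of the real number x; this tends to
    c (exp(b)^2 - exp(2 b)) = 0. *)

Local Open Scope classical_set_scope.
Local Open Scope ring_scope.

Set Implicit Arguments.
Unset Strict Implicit.
Unset Printing Implicit Defensive.

(** * Derivatives relative to a set *)

(** Differentiability relative to [A] implies continuity relative to [A]. *)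
Lemma is_derive_within_cvg (R : realType) (V : normedModType R) (A : set R)
    (f : R -> V) (t : R) (df : V) :
  is_derive_within A f t df -> f s @[s --> within A t^'] --> f t.
Proof.
move=> fd.
have st0 : s - t @[s --> within A t^'] --> (0 : R).
  have idt : s @[s --> within A t^'] --> t.
    by move=> P tP; apply: cvg_within; apply: cvg_within.
  by rewrite -(subrr t); exact: (cvgB idt (cvg_cst t)).
have lim_mul : (s - t) *: ((s - t)^-1 *: (f s - f t)) + f t
    @[s --> within A t^'] --> 0 *: df + f t.
  by apply: cvgD; [exact: cvgZ | exact: cvg_cst].
rewrite scale0r add0r in lim_mul; apply: cvg_trans lim_mul; apply: near_eq_cvg.
rewrite near_withinE near_withinE; apply: nearW => s /= st _.
by rewrite /= scalerA divff ?subr_eq0// scale1r subrK.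
Qed.

Lemma is_derive_within_coord (R : realType) (m n : nat) (A : set R)
    (C : R -> 'M[R]_(m, n)) (t : R) (d : 'M[R]_(m, n)) (i : 'I_m) (j : 'I_n) :
  is_derive_within A C t d ->
  is_derive_within A (fun s => C s i j) t (d i j).
Proof.
move=> Cd; rewrite /is_derive_within.
have Cdij : ((s - t)^-1 *: (C s - C t)) i j @[s --> within A t^'] --> d i j.
  exact: (cvg_comp _ _ Cd (@coord_continuous R m n i j d)).
apply: cvg_trans Cdij; apply: near_eq_cvg; apply: nearW => s /=.
by rewrite !mxE.
Qed.

Lemma is_derive_withinD (R : realType) (A : set R) (f g : R -> R)
    (t df dg : R) :
  is_derive_within A f t df -> is_derive_within A g t dg ->
  is_derive_within A (fun s => f s + g s) t (df + dg).
Proof.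
move=> fd gd; rewrite /is_derive_within.
have fgd : (s - t)^-1 *: (f s - f t) + (s - t)^-1 *: (g s - g t)
    @[s --> within A t^'] --> df + dg by exact: cvgD.
apply: cvg_trans fgd; apply: near_eq_cvg; apply: nearW => s /=.
by rewrite -scalerDr opprD addrACA.
Qed.

Lemma is_derive_within_sum (R : realType) (I : Type) (r : seq I) (A : set R)
    (f : I -> R -> R) (t : R) (df : I -> R) :
  (forall i, is_derive_within A (f i) t (df i)) ->
  is_derive_within A (fun s => \sum_(i <- r) f i s) t (\sum_(i <- r) df i).
Proof.
move=> fd; elim: r => [|i r IHr].
  rewrite /is_derive_within.
  under eq_fun do rewrite !big_nil subrr scaler0.
  by rewrite big_nil; exact: cvg_cst.
rewrite big_cons; under eq_fun do rewrite big_cons.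
exact: is_derive_withinD.
Qed.

Lemma is_derive_within_sqr (R : realType) (A : set R) (f : R -> R) (t df : R) :
  is_derive_within A f t df ->
  is_derive_within A (fun s => f s ^+ 2) t (2 * (f t * df)).
Proof.
move=> fd; rewrite /is_derive_within.
have -> : 2 * (f t * df) = df * (f t + f t) by ring.
have ffd : ((s - t)^-1 *: (f s - f t)) * (f s + f t)
    @[s --> within A t^'] --> df * (f t + f t).
  apply: cvgM => //; apply: cvgD; last exact: cvg_cst.
  exact: is_derive_within_cvg fd.
apply: cvg_trans ffd; apply: near_eq_cvg; apply: nearW => s /=.
by rewrite /GRing.scale /=; ring.
Qed.

Lemma is_derive_within_linear (R : realType) (A : set R) (a t : R) :
  is_derive_within A (fun s => a * s) t a.
Proof.
have aa : a @[_ --> within A t^'] --> a by exact: cvg_cst.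
apply: cvg_trans aa; apply: near_eq_cvg.
rewrite near_withinE near_withinE; apply: nearW => s /= st _.
by rewrite -mulrBr /GRing.scale /= mulrCA mulVf ?mulr1 // subr_eq0.
Qed.

(** At an interior point, the relative derivative is the usual one. *)
Lemma is_derive_within_interior (R : realType) (A : set R) (f : R -> R)
    (t df : R) :
  nbhs t A -> is_derive_within A f t df -> is_derive t 1 f df.
Proof.
move=> tA fd.
suff fd' : h^-1 *: (f (h *: 1 + t) - f t) @[h --> 0^'] --> df.
  split; first by apply/cvg_ex; exists df.
  exact: (cvg_lim _ fd').
have {}fd : (s - t)^-1 *: (f s - f t) @[s --> t^'] --> df.
  apply: cvg_trans fd; apply: cvg_app => P /=.
  rewrite /within /=; move: tA; apply: filterS2 => s As Ps st; exact: Ps.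
apply/cvgrPdist_lt => e e0; move/cvgrPdist_lt : fd => /(_ e e0) fde.
have : \forall s \near t, s != t -> `|df - (s - t)^-1 *: (f s - f t)| < e.
  exact: fde.
rewrite (near_shift 0 t) subr0; apply: filterS => h /= + h0.
rewrite /shift /= addrK /GRing.scale /= mulr1; apply.
by rewrite -subr_eq0 addrK.
Qed.

Lemma is_derive_within_0_cst (R : realType) (I : interval R) (g : R -> R) :
  (forall t, t \in I -> is_derive_within [set` I] g t 0) ->
  forall a b, a \in I -> b \in I -> g a = g b.
Proof.
move=> gd a b; wlog: a b / a < b.
  move=> H aI bI; have [ab|ba|->//] := ltgtP a b; first exact: H.
  by apply/esym/H.
move=> ab aI bI.
have subI : {subset `[a, b] <= I}.
  by move=> x; rewrite in_itv /=; exact: (interval_is_interval aI bI).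
have inner x : x \in `]a, b[ -> is_derive x 1 g 0.
  move=> xab; apply: (@is_derive_within_interior _ [set` I]).
    apply: filterS (near_in_itvoo xab) => y yab.
    by apply: subI; apply: subset_itv_oo_cc.
  by apply: gd; apply: subI; apply: subset_itv_oo_cc.
(* Continuity of g at c relative to a punctured set that lies in I near c;
   used for the one-sided neighborhoods of a and b. *)
have side (c : R) (B : set R) :
    c \in I -> (\forall x \near c, B x -> x \in I) -> (forall x, B x -> x != c) ->
    g x @[x --> within B (nbhs c)] --> g c.
  move=> cI BI Bc; have gc := is_derive_within_cvg (gd c cI).
  apply: cvg_trans gc.
  apply: cvg_app => P; rewrite /within /=.
  move: BI; apply: filterS2 => x BI Px Bx.
  by apply: Px; [exact: Bc | exact: BI].
have cont : {within `[a, b], continuous g}.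
  apply/continuous_within_itvP => //; split.
  - by move=> x /inner [gx _]; apply/differentiable_continuous/derivable1_diffP.
  - apply: side => //.
    + near=> x => /= ax; apply: subI; rewrite in_itv /= (ltW ax) ltW//.
      by near: x; exact: lt_nbhsl.
    + by move=> x /= /gt_eqF ->.
  - apply: side => //.
    + near=> x => /= xb; apply: subI; rewrite in_itv /= (ltW xb) andbT ltW//.
      by near: x; exact: lt_nbhsr.
    + by move=> x /= /lt_eqF ->.
have [c _] := MVT ab inner cont.
by rewrite mul0r => /eqP; rewrite subr_eq0 => /eqP.
Unshelve. all: by end_near. Qed.

(** * Euclidean norm and the differential equation *)

Lemma enorm_sqr (R : realType) (n : nat) (v : 'cV[R]_n) :
  enorm v ^+ 2 = \sum_(i < n) v i 0 ^+ 2.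
Proof. by rewrite sqr_sqrtr// sumr_ge0// => i _; exact: sqr_ge0. Qed.

Lemma enorm_sqr_mulmx (R : realType) (n : nat) (v : 'cV[R]_n) :
  enorm v ^+ 2 = (v^T *m v) 0 0.
Proof. by rewrite enorm_sqr mxE; apply: eq_bigr => i _; rewrite mxE expr2. Qed.

Lemma enorm_sqr_eq0 (R : realType) (n : nat) (v : 'cV[R]_n) :
  (enorm v ^+ 2 == 0) = (v == 0).
Proof.
apply/eqP/eqP => [|->]; last first.
  by rewrite enorm_sqr_mulmx mulmx0 mxE.
move=> /eqP; rewrite enorm_sqr psumr_eq0 => [/allP v0|i _]; last exact: sqr_ge0.
apply/colP => i; have := v0 i (mem_index_enum i).
by rewrite mxE sqrf_eq0 => /eqP.
Qed.

(** The adjoint of A^j is (-A)^j = (-1)^j A^j. *)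
Lemma antisymmetric_expr_adjoint (R : realType) (n : nat) (A : 'M[R]_n)
    (u v : 'cV[R]_n) (j : nat) :
  antisymmetric_mx A ->
  (A ^+ j *m u)^T *m v = (-1) ^+ j *: (u^T *m (A ^+ j *m v)).
Proof.
move=> hA; elim: j v => [|j IHj] v; first by rewrite !expr0 !mul1mx scale1r.
have -> : (A ^+ j.+1 *m u)^T *m v = - ((A ^+ j *m u)^T *m (A *m v)).
  by rewrite exprS -mulmxE -mulmxA trmx_mul hA mulmxN mulNmx -mulmxA.
rewrite IHj -scaleN1r scalerA -exprS; congr (_ *: (_ *m _)).
by rewrite mulmxA mulmxE -exprSr.
Qed.

(** The squared norm of a solution has derivative -2. *)
Lemma ode_solution_derive_sqr_norm (R : realType) (n : nat) (M : 'M[R]_n)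
    (I : interval R) (C : R -> 'cV[R]_n) (t : R) :
  antisymmetric_mx M -> ode_solution M I C -> t \in I ->
  is_derive_within [set` I] (fun s => enorm (C s) ^+ 2 + 2 * s) t 0.
Proof.
move=> hM hC tI; have [MC0 Cd] := hC t tI.
have -> : (fun s => enorm (C s) ^+ 2 + 2 * s) =
    (fun s => \sum_i C s i 0 ^+ 2 + 2 * s).
  by apply/funext => s; rewrite enorm_sqr.
set d := _ *: _ in Cd.
have d0 : \sum_i (2 * (C t i 0 * d i 0)) + 2 = 0.
  rewrite -mulr_sumr -[X in _ + X]mulr1 -mulrDr.
  have -> : \sum_i C t i 0 * d i 0 = ((C t)^T *m d) 0 0.
    by rewrite [RHS]mxE; apply: eq_bigr => i _; rewrite [(C t)^T 0 i]mxE.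
  rewrite /d -scalemxAr mxE.
  have := antisymmetric_expr_adjoint (C t) (M *m C t) 1 hM.
  rewrite !expr1 [M *m (M *m _)]mulmxA mulmxE -expr2 scaleN1r => MCE.
  rewrite -[in X in _ * X](opprK ((C t)^T *m _)) -MCE mxE -enorm_sqr_mulmx.
  by rewrite mulrN mulVf ?enorm_sqr_eq0// addNr mulr0.
rewrite -[X in is_derive_within _ _ _ X]d0.
apply: is_derive_withinD; last exact: is_derive_within_linear.
apply: is_derive_within_sum => i; apply: is_derive_within_sqr.
exact: is_derive_within_coord Cd.
Qed.

(** * Convergence of the matrix exponential *)

(** The sum of the absolute values of all entries is a submultiplicative norm
    that bounds each entry; the sup norm is not submultiplicative. *)
Lemma mx_expr_coord_le (R : realType) (n : nat) (A : 'M[R]_n) (k : nat)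
    (i j : 'I_n) :
  `|(A ^+ k) i j| <= (\sum_i \sum_j `|A i j|) ^+ k.
Proof.
elim: k i j => [|k IHk] i j.
  by rewrite !expr0 mxE; case: (i == j); rewrite ?normr1 ?normr0.
rewrite !exprS -mulmxE mxE (le_trans (ler_norm_sum _ _ _))//.
have sum0 l : 0 <= \sum_j `|A l j| by rewrite sumr_ge0.
apply: (@le_trans _ _ ((\sum_l `|A i l|) * (\sum_i \sum_j `|A i j|) ^+ k)).
  rewrite mulr_suml; apply: ler_sum => l _.
  by rewrite normrM ler_wpM2l.
rewrite ler_wpM2r ?exprn_ge0 ?sumr_ge0//.
by rewrite [leRHS](bigD1 i)//= lerDl sumr_ge0.
Qed.

Lemma cvg_mx_coord (R : realType) (m n : nat) (u : nat -> 'M[R]_(m, n))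
    (L : 'M[R]_(m, n)) :
  (forall i j, u k i j @[k --> \oo] --> L i j) -> u @ \oo --> L.
Proof.
move=> uL; apply/cvgrPdist_le => /= e e0; near=> k.
rewrite [leLHS]/Num.Def.normr /= mx_normrE (bigmax_le _ (ltW e0))//= => i _.
rewrite !mxE; move: i; near: k; apply: filter_forall => /= i.
exact: ((cvgrPdist_le _ _).1 (uL i.1 i.2)).
Unshelve. all: by end_near. Qed.

Lemma cvg_expmx (R : realType) (n : nat) (A : 'M[R]_n) :
  series (fun k => (k`!%:R)^-1 *: A ^+ k) @ \oo --> expmx A.
Proof.
set u := fun k => _.
suff : cvgn (series u) by [].
have cvg_ij i j : cvgn (series (fun k => u k i j)).
  apply: normed_cvg.
  have := is_cvg_series_exp_coeff (\sum_i \sum_j `|A i j|).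
  apply: series_le_cvg => k //=.
    by rewrite exp_coeff_ge0// sumr_ge0// => ? _; rewrite sumr_ge0.
  rewrite /u /exp_coeff /= mxE normrM mulrC ler_pM//.
    exact: mx_expr_coord_le.
  by rewrite ger0_norm.
apply/cvg_ex; exists (\matrix_(i, j) limn (series (fun k => u k i j))).
apply: cvg_mx_coord => i j; rewrite mxE.
under eq_fun do rewrite summxE.
exact: cvg_ij.
Qed.

(** * The exponential of an antisymmetric matrix is an isometry *)

(** The part j + k < N of a product of two truncated exponential series, with
    weights depending only on j + k, is grouped along the lines j + k = m by
    the binomial theorem. *)
Lemma double_sum_triangle (R : realType) (x y : R) (q : nat -> R) (N : nat) :
  \sum_(j < N) \sum_(k < N | (j + k < N)%N)
     x ^+ j / j`!%:R * (y ^+ k / k`!%:R) * q (j + k)%N =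
  \sum_(m < N) (x + y) ^+ m / m`!%:R * q m.
Proof.
transitivity (\sum_(m < N) \sum_(j < N) \sum_(k < N | (j + k == m)%N)
     x ^+ j / j`!%:R * (y ^+ k / k`!%:R) * q (j + k)%N).
  rewrite exchange_big; apply: eq_bigr => j _.
  rewrite [RHS](exchange_big_dep (fun k : 'I_N => j + k < N)%N) /=; last first.
    by move=> m k _ /eqP ->.
  apply: eq_bigr => k jkN; rewrite (big_pred1 (Ordinal jkN)) => [//|m].
  by rewrite -[RHS]/(m == Ordinal jkN) -val_eqE /= eq_sym.
apply: eq_bigr => m _; rewrite addrC exprDn mulr_suml mulr_suml.
rewrite (big_ord_widen _
  (fun j => (y ^+ (m - j) * x ^+ j *+ 'C(m, j)) / m`!%:R * q m) (ltn_ord m)).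
rewrite [RHS]big_mkcond; apply: eq_bigr => j _; rewrite ltnS.
case: leqP => jm; last first.
  rewrite big_pred0// => k; apply/eqP => jkm.
  by rewrite -jkm ltnNge leq_addr in jm.
have mjN : (m - j < N)%N by rewrite (leq_ltn_trans (leq_subr _ _)).
rewrite (big_pred1 (Ordinal mjN)) => [|k]; last first.
  by rewrite -[RHS]/(k == Ordinal mjN) -val_eqE /= -(eqn_add2l j k) subnKC.
rewrite /= subnKC// -(bin_fact jm) !natrM; congr (_ * _).
have f0 i : i`!%:R != 0 :> R by rewrite pnatr_eq0 -lt0n fact_gt0.
have c0 : 'C(m, j)%:R != 0 :> R by rewrite pnatr_eq0 -lt0n bin_gt0.
rewrite -mulr_natr; field.
by rewrite !f0 c0.
Qed.

(** The factor [1 ^+ k] gives the summand the shape of [double_sum_triangle]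
    for x = -1 and y = 1. *)
Lemma expmx_partial_sqr_norm (R : realType) (n : nat) (A : 'M[R]_n)
    (v : 'cV[R]_n) (N : nat) :
  antisymmetric_mx A ->
  enorm (series (fun k => (k`!%:R)^-1 *: A ^+ k) N *m v) ^+ 2 =
  \sum_(j < N) \sum_(k < N) (-1) ^+ j / j`!%:R * (1 ^+ k / k`!%:R) *
     (v^T *m (A ^+ (j + k) *m v)) 0 0.
Proof.
move=> hA; rewrite enorm_sqr_mulmx.
(* The same sum, with matrix addition and scaling in place of the operations
   of the normed module. *)
pose S : 'M[R]_n := \sum_(k < N) (k`!%:R)^-1 *: A ^+ k.
have -> : series (fun k => (k`!%:R)^-1 *: A ^+ k) N = S.
  by rewrite /series /= big_mkord.
rewrite {}/S mulmx_suml.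
rewrite [in X in X *m _](raddf_sum (@trmx R n 1)) /= mulmx_suml summxE.
apply: eq_bigr => j _.
rewrite mulmx_sumr summxE; apply: eq_bigr => k _.
rewrite -!scalemxAl -scalemxAr [(_ *: _)^T]linearZ /=.
rewrite -scalemxAl.
rewrite antisymmetric_expr_adjoint// (mulmxA (A ^+ j)) mulmxE -exprD !mxE.
by rewrite expr1n; ring.
Qed.

(** The right-hand side is the sum of the terms with j + k >= N + 1 in the
    square of the partial sum of the exponential series of [b], up to the
    factor c.  At least one term is needed, whence [N.+1]. *)
Lemma expmx_partial_sqr_norm_le (R : realType) (n : nat) (A : 'M[R]_n)
    (v : 'cV[R]_n) (N : nat) (b := \sum_i \sum_j `|A i j|) :
  antisymmetric_mx A ->
  `|enorm (series (fun k => (k`!%:R)^-1 *: A ^+ k) N.+1 *m v) ^+ 2 -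
    enorm v ^+ 2| <=
  (\sum_i \sum_j `|v i 0| * `|v j 0|) *
  (series (exp_coeff b) N.+1 * series (exp_coeff b) N.+1 -
   series (exp_coeff (b + b)) N.+1).
Proof.
move=> hA; set c := \sum_i \sum_j _.
pose q k := (v^T *m (A ^+ k *m v)) 0 0.
have b0 : 0 <= b by rewrite sumr_ge0// => ? _; rewrite sumr_ge0.
have q_le k : `|q k| <= c * b ^+ k.
  rewrite /q mxE (le_trans (ler_norm_sum _ _ _))//.
  rewrite /c mulr_suml ler_sum// => i _.
  rewrite !mxE mulr_sumr mulr_suml (le_trans (ler_norm_sum _ _ _))//.
  rewrite ler_sum// => j _.
  rewrite !normrM -mulrA ler_wpM2l// mulrC ler_wpM2l//.
  exact: mx_expr_coord_le.
have <- : \sum_(j < N.+1) \sum_(k < N.+1 | (j + k < N.+1)%N)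
     (-1) ^+ j / j`!%:R * (1 ^+ k / k`!%:R) * q (j + k)%N = enorm v ^+ 2.
  rewrite double_sum_triangle addNr big_ord_recl /= big1 => [|k _].
    by rewrite expr0 divr1 mul1r /q expr0 mul1mx -enorm_sqr_mulmx addr0.
  by rewrite expr0n /= !mul0r.
rewrite expmx_partial_sqr_norm// -sumrB.
have -> : c * (series (exp_coeff b) N.+1 * series (exp_coeff b) N.+1 -
    series (exp_coeff (b + b)) N.+1) =
  \sum_(j < N.+1) \sum_(k < N.+1 | ~~ (j + k < N.+1)%N)
    c * (b ^+ j / j`!%:R * (b ^+ k / k`!%:R)).
  have := double_sum_triangle b b (fun=> 1) N.+1.
  rewrite /series /= !big_mkord /exp_coeff.
  under [in X in _ = X -> _]eq_bigr do rewrite mulr1.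
  move=> <-; rewrite [X in X - _]mulr_suml -sumrB mulr_sumr.
  apply: eq_bigr => j _.
  rewrite [X in X - _]mulr_sumr (bigID (fun k : 'I__ => j + k < N.+1)%N) /=.
  under [X in _ - X]eq_bigr do rewrite mulr1.
  by rewrite [X in c * X]addrAC subrr add0r mulr_sumr.
rewrite (le_trans (ler_norm_sum _ _ _))// ler_sum// => j _.
rewrite (bigID (fun k : 'I__ => j + k < N.+1)%N) /= addrAC subrr add0r.
rewrite (le_trans (ler_norm_sum _ _ _))// ler_sum// => k _.
rewrite normrM; apply: le_trans (ler_wpM2l _ (q_le _)) _ => //.
rewrite !normrM normrX normrN1 expr1n mul1r expr1n normr1 mul1r !ger0_norm//.
by rewrite exprD le_eqVlt; apply/orP; left; apply/eqP; ring.
Qed.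

Lemma cvg_sum_seq (R : realType) (I : Type) (r : seq I) (f : I -> nat -> R)
    (l : I -> R) :
  (forall i, f i N @[N --> \oo] --> l i) ->
  \sum_(i <- r) f i N @[N --> \oo] --> \sum_(i <- r) l i.
Proof.
move=> fl; elim: r => [|i r IHr].
  by rewrite big_nil; under eq_fun do rewrite big_nil; exact: cvg_cst.
rewrite big_cons; under eq_fun do rewrite big_cons.
exact: cvgD.
Qed.

Lemma expmx_antisymmetric_sqr_norm (R : realType) (n : nat) (A : 'M[R]_n)
    (v : 'cV[R]_n) :
  antisymmetric_mx A -> enorm (expmx A *m v) ^+ 2 = enorm v ^+ 2.
Proof.
move=> hA.
pose S := series (fun k => (k`!%:R)^-1 *: A ^+ k).
have Sv : enorm (S N *m v) ^+ 2 @[N --> \oo] --> enorm (expmx A *m v) ^+ 2.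
  rewrite enorm_sqr; under eq_fun do rewrite enorm_sqr.
  apply: cvg_sum_seq => i; rewrite mxE; under eq_fun do rewrite mxE expr2.
  rewrite expr2.
  have Svi :
      \sum_j S N i j * v j 0 @[N --> \oo] --> \sum_j expmx A i j * v j 0.
    apply: cvg_sum_seq => j; apply: cvgM; last exact: cvg_cst.
    exact: (cvg_comp _ _ (cvg_expmx (A := A)) (@coord_continuous R n n i j _)).
  exact: cvgM.
have {}Sv : enorm (S N.+1 *m v) ^+ 2 @[N --> \oo] --> enorm (expmx A *m v) ^+ 2.
  by move: Sv; rewrite -cvg_shiftS.
suff Sv' : enorm (S N.+1 *m v) ^+ 2 @[N --> \oo] --> enorm v ^+ 2.
  exact: (cvg_unique _ Sv Sv').
pose b : R := \sum_i \sum_j `|A i j|.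
pose c : R := \sum_i \sum_j `|v i 0| * `|v j 0|.
have exp_cvg (x : R) : series (exp_coeff x) N.+1 @[N --> \oo] --> expR x.
  have := is_cvg_series_exp_coeff x; rewrite -cvg_shiftS.
  exact.
have bound_cvg0 : c * (series (exp_coeff b) N.+1 * series (exp_coeff b) N.+1 -
    series (exp_coeff (b + b)) N.+1) @[N --> \oo] --> 0.
  rewrite -(mulr0 c) -(subrr (expR (b + b))) {1}expRD.
  apply: cvgM; first exact: cvg_cst.
  apply: cvgB; last exact: exp_cvg.
  by apply: cvgM; exact: exp_cvg.
apply/subr_cvg0; apply: norm_cvg0.
apply: squeeze_cvgr (cvg_cst 0) bound_cvg0; apply: nearW => N /=.
by rewrite normr_ge0 expmx_partial_sqr_norm_le.
Qed.

Unset Implicit Arguments.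
Set Strict Implicit.
Set Printing Implicit Defensive.

Theorem lemma3p1 (R : realType) (n : nat) (M : 'M[R]_n)
    (I : interval R) (C0 : R -> 'cV[R]_n)
    (hM : antisymmetric_mx M) (hC0 : ode_solution M I C0) :
  exists T : R,
    (forall t : R, t \in I -> enorm (C0 t) ^+ 2 = 2 * (T - t)) /\
    (forall t : R, t \in I ->
       forall eps : R,
         curve M C0 t eps \in sphere 0 (Num.sqrt (2 * (T - t)))).
Proof.
(* If the interval is empty, any T will do. *)
have [[t0 t0I]|noI] := pselect (exists t, t \in I); last first.
  by exists 0; split=> t tI; case: noI; exists t.
exists (t0 + enorm (C0 t0) ^+ 2 / 2).
have norm_C t : t \in I ->
    enorm (C0 t) ^+ 2 = 2 * (t0 + enorm (C0 t0) ^+ 2 / 2 - t).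
  move=> tI.
  have := is_derive_within_0_cst
    (fun s => ode_solution_derive_sqr_norm hM hC0) tI t0I.
  move=> /= h; lra.
split=> // t tI eps.
have epsM : antisymmetric_mx (eps *: M).
  by rewrite /antisymmetric_mx linearZ /= hM scalerN.
rewrite inE /sphere /= subr0 -norm_C// /curve.
rewrite -(expmx_antisymmetric_sqr_norm _ epsM) sqrtr_sqr ger0_norm//.
exact: sqrtr_ge0.
Qed.
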